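(* Let $A$ be a nonempty closed class of decision tables from $\mathcal{M}_k^2$ for which the function $S$ is not bounded from above. Then $F^W_{h,A}(n)=F^\Theta_{h,A}(n)=n$ for every $n\in\omega$.
   Context: Fix an integer $k\ge 2$; $\omega=\{0,1,2,\ldots\}$, $E_k=\{0,1,\ldots,k-1\}$, $E_2=\{0,1\}$. Let $P=\{f_i:i\in\omega\}$ be a set of attribute names ($f_i\ne f_j$ for $i\ne j$). $\mathcal{M}_k^2$ is the set of rectangular tables filled with numbers from $E_k$ whose columns are labeled with pairwise different attributes from $P$, whose rows are pairwise different, and in which each row is labeled with a decision from $E_2$; rows are tuples of values of the column attributes. Tables without rows also belong to $\mathcal{M}_k^2$ and are all denoted $\Lambda$. Tables differing only by a permutation of rows are equal. $P(T)$ is the set of column attributes of $T$. $\mathcal{M}_k^2\mathcal{C}$ is the set of tables in which all rows have the same decision ($\Lambda$ included). For $f_{i_1},\ldots,f_{i_m}\in P(T)$, $\delta_j\in E_k$, $T(f_{i_1},\delta_1)\cdots(f_{i_m},\delta_m)$ is the table of rows of $T$ having values $\delta_1,\ldots,\delta_m$ in the columns $f_{i_1},\ldots,f_{i_m}$. Operations: for $D\subseteq P(T)$, $I(D,T)$ deletes the columns labeled by $D$ and, in each group of rows coinciding on the remaining columns, keeps one row with the minimum decision; $I(P(T),T)=\Lambda$. For $\nu:E_k^{|P(T)|}\to E_2$, $J(\nu,T)$ replaces the decision of each row $\bar\delta$ by $\nu(\bar\delta)$. $[T]=\{J(\nu,I(D,T)):D\subseteq P(T),\nu:E_k^{|P(T)\setminus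 D|}\to E_2\}$; $[A]=\bigcup_{T\in A}[T]$; $A\ne\emptyset$ is a closed class if $[A]=A$. A test of $T$ is $D\subseteq P(T)$ such that any two rows with different decisions differ in some column labeled from $D$ (for $T\in\mathcal{M}_k^2\mathcal{C}$ every subset, including $\emptyset$, is a test). A $k$-decision tree is a finite directed rooted tree with at least two nodes, root and its leaving edges unlabeled, terminal nodes labeled with decisions from $E_2$, other nodes labeled with attributes from $P$ whose leaving edges are labeled with numbers from $E_k$. $P(\Gamma)$ is the set of attributes at nodes. For a complete path $\tau=v_1,d_1,\ldots,v_m,d_m,v_{m+1}$ from the root to a terminal node, its length in attribute nodes is $m-1$; $T(\tau)=T$ if $m=1$, else $T(f_{i_2},\delta_2)\cdots(f_{i_m},\delta_m)$ with $v_j$ labeled $f_{i_j}$ and $d_j$ labeled $\delta_j$. For $T\ne\Lambda$, a deterministic decision tree for $T$: exactly one edge leaves the root, edges leaving any other nonterminal node have pairwise different labels, $P(\Gamma)\subseteq P(T)$, every row of $T$ lies in some $T(\tau)$, and for every complete path either $T(\tau)=\Lambda$ or all rows of $T(\tau)$ have the terminal node's decision. The depth $h(\Gamma)$ is the maximum over complete paths of the number $m-1$ of attribute-labeled nodes on the path. For $T\ne\Lambda$: $h^d(T)$ is the minimum depth of a deterministic decision tree for $T$; $\Theta(T)$ is the minimum cardinality of a test of $T$; $W(T)$ is the number of columns of $T$; for a row $\bar\delta$, $S(T,\bar\delta)$ is the minimum cardinality of $D\subseteq P(T)$ such that on the columns labeled by $D$ the row $\bar\delta$ differs from all other rows, and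 $S(T)=\max_{\bar\delta}S(T,\bar\delta)$. All these are $0$ on $\Lambda$. $F^W_{h,A}(n)=\max\{h^d(T):T\in A,W(T)\le n\}$ and $F^\Theta_{h,A}(n)=\max\{h^d(T):T\in A,\Theta(T)\le n\}$. *)

(* Defs.v *)
From HB Require Import structures.
From mathcomp Require Import all_boot all_order finmap.
From mathcomp Require Import boolp classical_sets.

Set Implicit Arguments.
Unset Strict Implicit.
Unset Printing Implicit Defensive.

Import Order.TTheory.

Local Open Scope fset_scope.
Local Open Scope fmap_scope.
Local Open Scope classical_set_scope.

(* Minimum of a set of naturals; only used on nonempty sets (see
   [tests_neq0], [separators_neq0] and [det_trees_neq0]). *)
Definition least (E : set nat) : nat :=
  if pselect (exists n, `[< E n >]) is left exE then ex_minn exE else 0.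

Definition is_max (E : set nat) (m : nat) : Prop :=
  E m /\ forall n, E n -> n <= m.

(* Maximum of a set of naturals, [None] when there is none. *)
Definition greatest (E : set nat) : option nat :=
  if pselect (exists m, is_max E m) is left exE
  then Some (projT1 (cid exE)) else None.

Lemma leastP (E : set nat) :
  E !=set0 -> E (least E) /\ (forall n, E n -> least E <= n).
Proof.
case=> n En; rewrite /least; case: pselect => [exE|]; last first.
  by case; exists n; apply/asboolP.
case: ex_minnP => m /asboolP Em mmin; split=> // p Ep.
exact/mmin/asboolP.
Qed.

Lemma greatestP (E : set nat) m : greatest E = Some m <-> is_max E m.
Proof.
rewrite /greatest; case: pselect => [exE|nE]; last first.
  by split=> // Em; case: nE; exists m.
case: cid => n [En nmax] /=; split=> [[<-] //|[Em mmax]].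
by congr Some; apply/eqP; rewrite eqn_leq mmax ?nmax.
Qed.

(* The attribute [f_i] is represented by its index [i : nat]. *)
Notation attr := nat (only parsing).

(* A finite map from rows to decisions makes rows pairwise different and their
   order irrelevant.  A table is without rows exactly when it is without
   columns: this makes the empty table unique, and agrees with the convention
   that deleting all the columns gives the empty table. *)
Definition table_ok k (t : seq attr * {fmap seq 'I_k -> 'I_2}) : bool :=
  [&& uniq t.1, [forall r : domf t.2, size (val r) == size t.1]
    & (t.1 == [::]) == (t.2 == [fmap])].

Record table k :=
  Table { tval : seq attr * {fmap seq 'I_k -> 'I_2}; _ : table_ok tval }.

HB.instance Definition _ k := [isSub for @tval k].
HB.instance Definition _ k := [Equality of table k by <:].

Lemma table_ok0 k : table_ok ([::], [fmap] : {fmap seq 'I_k -> 'I_2}).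
Proof.
by rewrite /table_ok /= !eqxx andbT; apply/forallP => -[r rP];
exfalso; rewrite inE in rP.
Qed.

Definition Lambda k : table k := Table (table_ok0 k).

(* If [c] is duplicate-free and the rows of [m] have length [size c], this is
   the table with columns [c] and rows [m], which is [Lambda] when [c] or [m]
   is empty (see [mk_tableE]). *)
Definition mk_table k (c : seq attr) (m : {fmap seq 'I_k -> 'I_2}) : table k :=
  insubd (Lambda k) (c, m).

Section Tables.
Variable k : nat.
Implicit Types (T : table k) (D : {fset attr}) (r : seq 'I_k) (f : attr).

Definition cols T : seq attr := (tval T).1.
Definition rows T : {fmap seq 'I_k -> 'I_2} := (tval T).2.
Definition colset T : {fset attr} := [fset f in cols T].
Definition W T : nat := size (cols T).

Lemma row_size T (r : domf (rows T)) : size (val r) == W T.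
Proof. by case: T r => t ok r; case/and3P: (ok) => _ /forallP/(_ r). Qed.

Definition row_tuple T (r : domf (rows T)) : (W T).-tuple 'I_k :=
  Tuple (row_size r).

(* The value of the row [r] in the column [f], [None] if there is none. *)
Definition cell T r f : option 'I_k := onth r (index f (cols T)).

(* T(f_1, d_1)...(f_m, d_m) *)
Definition restrict T (p : seq (attr * 'I_k)) : table k :=
  mk_table (cols T)
    (filterf (rows T) (fun r => all (fun q => cell T r q.1 == Some q.2) p)).

Definition project D T r : seq 'I_k := mask [seq f \notin D | f <- cols T] r.

(* [ord_max], the decision 1, is neutral for the minimum, which is taken over a
   nonempty group of rows; the result is [Lambda] if [D] is [colset T]. *)
Definition delete D T : table k :=
  mk_table [seq f <- cols T | f \notin D]
    [fmap s : [fset project D T r | r in domf (rows T)] =>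
       \big[Order.min/ord_max]_(r : domf (rows T) |
                                project D T (val r) == val s) rows T r].

Definition relabel T (nu : (W T).-tuple 'I_k -> 'I_2) : table k :=
  mk_table (cols T) [fmap r : domf (rows T) => nu (row_tuple r)].

Definition span T : set (table k) :=
  [set T' | exists D (nu : (W (delete D T)).-tuple 'I_k -> 'I_2),
              (D `<=` colset T)%fset /\ T' = relabel nu].

Definition closed_class (A : set (table k)) : Prop :=
  A !=set0 /\ \bigcup_(T in A) span T = A.

Definition is_test T D : Prop :=
  (D `<=` colset T)%fset /\
  forall r1 r2 : domf (rows T), rows T r1 != rows T r2 ->
    exists2 f, f \in D & cell T (val r1) f != cell T (val r2) f.

(* [W], [Theta] and [S] need no special case on [Lambda], where they are 0. *)
Definition Theta T : nat := least [set #|` D| | D in [set D | is_test T D]].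

Definition separates T (r : domf (rows T)) D : Prop :=
  (D `<=` colset T)%fset /\
  forall r' : domf (rows T), r' != r ->
    exists2 f, f \in D & cell T (val r) f != cell T (val r') f.

Definition S_at T (r : domf (rows T)) : nat :=
  least [set #|` D| | D in [set D | separates r D]].

Definition S T : nat := \max_(r : domf (rows T)) S_at r.

End Tables.

(* The nodes other than the root: [Query f es] is labeled with [f], and each
   [(d, s)] in [es] is a leaving edge labeled with [d] and entering [s]. *)
Inductive node (k : nat) : Type :=
| Terminal of 'I_2
| Query of attr & seq ('I_k * node k).
Arguments Terminal {k} _.
Arguments Query {k} _ _.

Section Trees.
Variable k : nat.
Implicit Types (T : table k) (s : node k).

Fixpoint node_ok s : bool :=
  match s with
  | Terminal _ => true
  | Query _ es => (0 < size es) && all (fun e => node_ok e.2) es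
  end.

(* A tree is given by the children of its root. *)
Record dtree := DTree
  { children : seq (node k);
    _ : (0 < size children) && all node_ok children }.

Fixpoint node_attrs s : seq attr :=
  match s with
  | Terminal _ => [::]
  | Query f es => f :: flatten [seq node_attrs e.2 | e <- es]
  end.

Definition tree_attrs (G : dtree) : seq attr :=
  flatten [seq node_attrs s | s <- children G].

(* Each complete path is recorded as the sequence of its (attribute, edge
   label) pairs together with the decision at its terminal node. *)
Fixpoint node_paths s : seq (seq (attr * 'I_k) * 'I_2) :=
  match s with
  | Terminal d => [:: ([::], d)]
  | Query f es =>
      flatten [seq [seq ((f, e.1) :: p.1, p.2) | p <- node_paths e.2] | e <- es]
  end.

Definition complete_paths (G : dtree) : seq (seq (attr * 'I_k) * 'I_2) :=
  flatten [seq node_paths s | s <- children G].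

Definition depth (G : dtree) : nat :=
  \max_(p <- complete_paths G) size p.1.

Fixpoint node_deterministic s : bool :=
  match s with
  | Terminal _ => true
  | Query _ es =>
      uniq [seq e.1 | e <- es] && all (fun e => node_deterministic e.2) es
  end.

Definition det_tree_for T (G : dtree) : Prop :=
  [/\ size (children G) = 1, all node_deterministic (children G),
      {subset tree_attrs G <= colset T},
      forall r, r \in domf (rows T) ->
        exists2 p, p \in complete_paths G & r \in domf (rows (restrict T p.1))
    & forall p, p \in complete_paths G ->
        restrict T p.1 = Lambda k \/
        forall r : domf (rows (restrict T p.1)),
          rows (restrict T p.1) r = p.2].

Definition hd T : nat :=
  if T == Lambda k then 0 else least [set depth G | G in [set G | det_tree_for T G]].

(* [F psi A] is the function [F^psi_{h,A}]; [None] means that the maximum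
   does not exist. *)
Definition F (psi : table k -> nat) (A : set (table k)) (n : nat) : option nat :=
  greatest [set hd T | T in [set T | A T /\ psi T <= n]].

End Trees.

Lemma mk_tableE k c (m : {fmap seq 'I_k -> 'I_2}) :
  uniq c -> (forall r, r \in domf m -> size r = size c) ->
  tval (mk_table c m) =
    if (c == [::]) || (m == [fmap]) then ([::], [fmap]) else (c, m).
Proof.
move=> Uc sz; rewrite /mk_table val_insubd.
have -> : table_ok (c, m) = ((c == [::]) == (m == [fmap])).
  rewrite /table_ok /= Uc /=.
  have -> // : [forall r : domf m, size (val r) == size c].
  by apply/forallP => r; rewrite sz ?fsvalP.
by case: (c =P [::]) => [->|]; case: (m =P [fmap]) => [->|].
Qed.

Section NonEmpty.
Variable k : nat.
Implicit Types (T : table k) (r : seq 'I_k).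

Lemma cols_uniq T : uniq (cols T).
Proof. by case: T => t ok; case/and3P: (ok). Qed.

Lemma size_row T r : r \in domf (rows T) -> size r = size (cols T).
Proof. by move=> rT; apply/eqP; exact: (@row_size k T [` rT]). Qed.

Lemma cell_inj T r1 r2 : r1 \in domf (rows T) -> r2 \in domf (rows T) ->
  {in cols T, cell T r1 =1 cell T r2} -> r1 = r2.
Proof.
move=> /size_row s1 /size_row s2 eqr.
apply: (inj_map (@Some_inj _)); apply: (@eq_from_nth _ None).
  by rewrite !size_map s1 s2.
move=> i; rewrite size_map s1 => ic; rewrite -!onthE.
have := eqr (nth 0 (cols T) i) (mem_nth _ ic).
by rewrite /cell index_uniq ?cols_uniq.
Qed.

Lemma cell_neq T (r1 r2 : domf (rows T)) : r1 != r2 ->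
  exists2 f, f \in colset T & cell T (val r1) f != cell T (val r2) f.
Proof.
move=> neq.
have /hasP[f fT df] : has (fun f => cell T (val r1) f != cell T (val r2) f) (cols T).
  apply: contraNT neq => /hasPn eqr; apply/eqP/val_inj.
  apply: (@cell_inj T); rewrite ?fsvalP// => f /eqr.
  by rewrite negbK => /eqP.
by exists f; rewrite // !inE.
Qed.

Lemma tests_neq0 T : [set D | is_test T D] !=set0.
Proof.
exists (colset T); split=> [|r1 r2 neq]; first exact: fsubset_refl.
by apply: cell_neq; apply: contra_neq neq => ->.
Qed.

Lemma separators_neq0 T (r : domf (rows T)) : [set D | separates r D] !=set0.
Proof.
exists (colset T); split=> [|r' neq]; first exact: fsubset_refl.
by apply: cell_neq; rewrite eq_sym.
Qed.

Lemma table_emptyE T : (cols T == [::]) = (rows T == [fmap]).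
Proof. by case: T => t ok; case/and3P: (ok) => _ _ /eqP. Qed.

Lemma rows_restrict T p :
  rows (restrict T p) =
    filterf (rows T) (fun r => all (fun q => cell T r q.1 == Some q.2) p).
Proof.
rewrite /rows mk_tableE ?cols_uniq// => [|r]; last first.
  by rewrite mem_filterf => /andP[/size_row].
rewrite table_emptyE; case: eqP => [r0|_] /=; last by case: eqP.
apply/esym/fmap_nil/fsetP => r; rewrite -[tval T]/(tval T) mem_filterf.
by rewrite -/(rows T) r0 inE.
Qed.

Lemma decision_restrict T p (r : domf (rows (restrict T p))) :
  Some (rows (restrict T p) r) = (rows T).[? val r].
Proof.
have rE := rows_restrict T p; move: (rows (restrict T p)) rE r => m -> r.
have := fsvalP r; rewrite mem_filterf => /andP[_ rp].
by rewrite Some_fnd fnd_filterf rp.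
Qed.

(* Queries all the columns in turn, [acc] being the values already read. *)
Fixpoint full_node T (c : seq attr) (acc : seq 'I_k) : node k :=
  if c is f :: c'
  then Query f [seq (d, full_node T c' (rcons acc d)) | d <- enum 'I_k]
  else Terminal (odflt ord0 (rows T).[? acc]).

Lemma full_node_ok T c acc : 0 < k -> node_ok (full_node T c acc).
Proof.
move=> k0; elim: c acc => //= f c IH acc.
rewrite size_map size_enum_ord k0 /= all_map.
by apply/allP => d _ /=.
Qed.

Lemma full_node_deterministic T c acc : node_deterministic (full_node T c acc).
Proof.
elim: c acc => //= f c IH acc; rewrite -map_comp map_id enum_uniq /= all_map.
by apply/allP => d _ /=.
Qed.

Lemma full_node_attrs T c acc : {subset node_attrs (full_node T c acc) <= c}.
Proof.
elim: c acc => //= f c IH acc g; rewrite !inE => /orP[-> //|].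
rewrite -map_comp => /flatten_mapP[d _ /= /IH ->].
by rewrite orbT.
Qed.

Lemma full_node_paths T c acc p :
  p \in node_paths (full_node T c acc) <->
  exists2 r, size r = size c & p = (zip c r, odflt ord0 (rows T).[? acc ++ r]).
Proof.
elim: c acc p => [|f c IH] acc p /=.
  rewrite inE; split=> [/eqP ->|[r /size0nil -> ->]]; last by rewrite cats0.
  by exists [::]; rewrite ?cats0.
rewrite -map_comp; split.
  move=> /flatten_mapP[d _ /= /mapP[q /IH[r sr ->] ->]] /=.
  by exists (d :: r); rewrite /= ?sr// cat_rcons.
case=> -[//|d r] /= [sr] ->; apply/flatten_mapP; exists d; first by rewrite mem_enum.
apply/mapP; exists (zip c r, odflt ord0 (rows T).[? rcons acc d ++ r]).
  by apply/IH; exists r.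
by rewrite /= cat_rcons.
Qed.

Lemma all_cell_zip (c : seq attr) (r r' : seq 'I_k) :
  uniq c -> size r = size c -> size r' = size c ->
  all (fun q => onth r' (index q.1 c) == Some q.2) (zip c r) = (r' == r).
Proof.
elim: c r r' => [|f c IH] [|d r] [|d' r'] //= /andP[fc Uc] [sr] [sr'].
rewrite eqxx /= eqseq_cons; congr andb; rewrite -(IH r r')//.
apply: eq_in_all => -[g e] /= /(map_f fst); rewrite -/(unzip1 _) unzip1_zip ?sr// => gc.
by have [fg|//] := eqVneq f g; rewrite fg gc in fc.
Qed.

Lemma det_trees_neq0 T : T != Lambda k -> [set G | det_tree_for T G] !=set0.
Proof.
move=> TL.
have k0 : 0 < k.
  have : rows T != [fmap].
    apply: contra_neq TL => r0; have := r0; move/eqP.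
    rewrite -table_emptyE => /eqP; move: r0; rewrite /cols /rows => r0 c0.
    by apply/val_inj => /=; move: r0 c0; case: (tval T) => c m /= -> ->.
  have [/fmap_nil -> /eqP //|[r rT]] := fset_0Vmem (domf (rows T)).
  rewrite -table_emptyE -size_eq0 -(size_row rT).
  by case: r {rT} => [|[d dk]]//= _ _; apply: leq_ltn_trans dk.
have G_ok : (0 < size [:: full_node T (cols T) [::]]) &&
            all (@node_ok k) [:: full_node T (cols T) [::]].
  by rewrite /= full_node_ok.
have pathsE p : p \in complete_paths (DTree G_ok) <->
    exists2 r, size r = size (cols T)
             & p = (zip (cols T) r, odflt ord0 (rows T).[? r]).
  by rewrite /complete_paths /= cats0 full_node_paths.
have inE' r r' : size r = size (cols T) ->
    (r' \in domf (rows (restrict T (zip (cols T) r)))) =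
    (r' \in domf (rows T)) && (r' == r).
  move=> sr; rewrite rows_restrict mem_filterf; case: (boolP (r' \in _)) => //= r'T.
  by rewrite -(all_cell_zip (cols_uniq T) sr (size_row r'T)).
exists (DTree G_ok); split=> //=.
- by rewrite full_node_deterministic.
- move=> f; rewrite /tree_attrs /= cats0 => /full_node_attrs.
  by rewrite !inE.
- move=> r rT; exists (zip (cols T) r, odflt ord0 (rows T).[? r]).
    by apply/pathsE; exists r; rewrite ?(size_row rT).
  by rewrite inE' ?(size_row rT)// rT eqxx.
- move=> p /pathsE[r sr ->] /=; right=> r'.
  have := fsvalP r'; rewrite inE'// => /andP[r'T /eqP r'r].
  apply: Some_inj; rewrite (decision_restrict r').
  by rewrite -[val r']/(fsval r') r'r in r'T *; rewrite (in_fnd r'T).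
Qed.

End NonEmpty.

(* Main.v *)
(** Querying the columns of a test one after another solves a table, so
    [h^d <= Theta <= W].  For the lower bound, take a row [r] with
    [S(T, r) >= n] and a separator [D] of [r] of minimum size.  By minimality,
    for every [f] in [D] some row differs from [r] on [D] in the column [f]
    only, and this survives in the table that keeps just [n] columns of [D].
    Relabel that table so that [r] alone gets its own decision: the path
    followed by [r] in a deterministic tree must then query all [n] columns. *)
Require Import Defs.
From mathcomp Require Import all_boot all_order finmap.
From mathcomp Require Import boolp classical_sets.

Set Implicit Arguments.
Unset Strict Implicit.
Unset Printing Implicit Defensive.

Section Bounds.
Local Open Scope fset_scope.
Local Open Scope fmap_scope.
Variable k : nat.
Implicit Types (T : table k) (D : {fset nat}).

(** * Upper bounds on the depth by tests and columns *)

Lemma cell_some T r f : r \in domf (rows T) -> f \in cols T ->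
  exists d, cell T r f = Some d.
Proof.
move=> rT fT; rewrite /cell.
have : index f (cols T) < size r by rewrite (size_row rT) index_mem.
case: r rT => [//|d r] _ lt; exists (nth d (d :: r) (index f (cols T))).
by rewrite onthE (nth_map d).
Qed.

Lemma cell_cols T r f : r \in domf (rows T) -> cell T r f -> f \in cols T.
Proof.
by move=> rT; rewrite /cell -index_mem -(size_row rT) -onthTE.
Qed.

Lemma card_colset T : #|` colset T| = W T.
Proof. by rewrite card_fseq undup_id ?cols_uniq. Qed.

Lemma mem_restrict T p r :
  (r \in domf (rows (restrict T p))) =
  (r \in domf (rows T)) && all (fun q => cell T r q.1 == Some q.2) p.
Proof. by rewrite rows_restrict mem_filterf. Qed.

(** After all the columns of a test have been read, the picked row is immaterial: the subtable has a
    single decision. The default [ord0] is for a path that no row follows, where any decision is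
    allowed. *)
Definition some_decision T (p : seq (nat * 'I_k)) : 'I_2 :=
  odflt ord0 (omap (rows (restrict T p))
    [pick r : domf (rows (restrict T p))]).

(** Unlike in [full_node], the values read need not form a whole row, so [acc] keeps them together
    with their attributes and the terminal node consults a subtable. *)
Fixpoint query_node T (c : seq nat) (acc : seq (nat * 'I_k)) : node k :=
  if c is f :: c'
  then Query f [seq (d, query_node T c' (rcons acc (f, d))) | d <- enum 'I_k]
  else Terminal (some_decision T acc).

Lemma query_node_ok T c acc : 0 < k -> node_ok (query_node T c acc).
Proof.
move=> k0; elim: c acc => //= f c IH acc.
rewrite size_map size_enum_ord k0 /= all_map.
by apply/allP => d _ /=.
Qed.

Lemma query_node_deterministic T c acc :
  node_deterministic (query_node T c acc).
Proof.
elim: c acc => //= f c IH acc; rewrite -map_comp map_id enum_uniq /= all_map.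
by apply/allP => d _ /=.
Qed.

Lemma query_node_attrs T c acc :
  {subset node_attrs (query_node T c acc) <= c}.
Proof.
elim: c acc => //= f c IH acc g; rewrite !inE => /orP[-> //|].
rewrite -map_comp => /flatten_mapP[d _ /= /IH ->].
by rewrite orbT.
Qed.

Lemma query_node_paths T c acc p : p \in node_paths (query_node T c acc) ->
  unzip1 p.1 = c /\ p.2 = some_decision T (acc ++ p.1).
Proof.
elim: c acc p => [|f c IH] acc p /=.
  by rewrite inE => /eqP ->; rewrite cats0.
rewrite -map_comp => /flatten_mapP[d _ /= /mapP[q /IH[<- ->] ->]] /=.
by rewrite cat_rcons.
Qed.

(** The row follows the edges labeled with its own values, which exist because every node has an
    edge for each element of ['I_k]. The accumulator affects the terminal labels only. *)
Lemma query_node_cover T c acc r : r \in domf (rows T) ->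
  {subset c <= cols T} ->
  exists2 p, p \in node_paths (query_node T c acc) &
             all (fun q => cell T r q.1 == Some q.2) p.1.
Proof.
move=> rT; elim: c acc => [|f c IH] acc sub /=.
  by exists ([::], some_decision T acc); rewrite ?inE.
have [d rd] := cell_some rT (sub f (mem_head f c)).
have [|p pP rp] := IH (rcons acc (f, d)).
  by move=> g gc; apply: sub; rewrite inE gc orbT.
exists ((f, d) :: p.1, p.2); last by rewrite /= rd eqxx.
rewrite -map_comp; apply/flatten_mapP; exists d; first by rewrite mem_enum.
by apply/mapP; exists p.
Qed.

(** Two rows on the same path of the tree querying [D] agree on [D], so by the definition of a test
    they cannot have different decisions. *)
Lemma hd_le_test T D : 0 < k -> is_test T D -> hd T <= #|` D|.
Proof.
move=> k0 [/fsubsetP DT testD]; rewrite /hd; case: eqP => // _.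
have subD : {subset enum_fset D <= cols T} by move=> f /DT; rewrite inE.
have G_ok : (0 < size [:: query_node T (enum_fset D) [::]]) &&
            all (@node_ok k) [:: query_node T (enum_fset D) [::]].
  by rewrite /= query_node_ok.
pose G := DTree G_ok.
have pathG p : p \in complete_paths G ->
    unzip1 p.1 = enum_fset D /\ p.2 = some_decision T p.1.
  by rewrite /complete_paths /= cats0 => /query_node_paths.
have GT : det_tree_for T G.
  split=> //=.
  - by rewrite query_node_deterministic.
  - move=> f; rewrite /tree_attrs /= cats0 => /query_node_attrs.
    exact: DT.
  - move=> r rT; have [p pP rp] := query_node_cover [::] rT subD.
    by exists p; rewrite ?mem_restrict ?rT// /complete_paths /= cats0.
  - move=> p /pathG[pD ->]; right=> r; rewrite /some_decision.
    case: pickP => [r' _|/(_ r)//] /=.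
    have := fsvalP r; rewrite mem_restrict => /andP[rT rp].
    have := fsvalP r'; rewrite mem_restrict => /andP[r'T r'p].
    apply: Some_inj; rewrite (decision_restrict r) (decision_restrict r').
    rewrite !in_fnd; congr Some; apply/eqP; apply: contraT => neq.
    have [f fD] := testD _ _ neq; rewrite /=.
    have /mapP[q qp ->] : f \in unzip1 p.1 by rewrite pD.
    by rewrite (eqP (allP rp q qp)) (eqP (allP r'p q qp)) eqxx.
have neG : ([set depth G | G in [set G | det_tree_for T G]] !=set0)%classic.
  by exists (depth G), G.
have [_ /(_ (depth G))] := leastP neG.
move=> le; apply: leq_trans (le _) _; first by exists G.
apply/bigmax_leqP_seq => p /pathG[pD _] _.
by rewrite -(size_map fst) -/(unzip1 _) pD.
Qed.

Lemma hd_le_Theta T : 0 < k -> hd T <= Theta T.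
Proof.
move=> k0.
have ne : ([set #|` D| | D in [set D | is_test T D]] !=set0)%classic.
  by have [D tD] := tests_neq0 T; exists #|` D|, D.
by rewrite /Theta; have [[D tD <-] _] := leastP ne; apply: hd_le_test.
Qed.

Lemma Theta_le_W T : Theta T <= W T.
Proof.
have tT : is_test T (colset T).
  split=> [|r1 r2 neq]; first exact: fsubset_refl.
  by apply: cell_neq; apply: contra_neq neq => ->.
have ne : ([set #|` D| | D in [set D | is_test T D]] !=set0)%classic.
  by exists #|` colset T|, (colset T).
have [_ le] := leastP ne; rewrite -card_colset.
by apply: le; exists (colset T).
Qed.

(** * Lower bound on the depth from a critical row *)

(** If the path of [r] avoided the column [f], the row [r'] that differs from [r] in [f] alone would
    follow it too and receive the same decision. *)
Lemma W_le_hd T r : r \in domf (rows T) ->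
  (forall f, f \in cols T -> exists r',
    [/\ r' \in domf (rows T), (rows T).[? r'] <> (rows T).[? r]
      & forall g, g != f -> g \in cols T -> cell T r' g = cell T r g]) ->
  W T <= hd T.
Proof.
move=> rT crit; rewrite /hd; case: eqP => [TL|/eqP TL].
  by move: rT; rewrite TL inE.
have neG : ([set depth G | G in [set G | det_tree_for T G]] !=set0)%classic.
  by have [G GT] := det_trees_neq0 TL; exists (depth G), G.
have [[G [_ _ _ coverG pathG] <-] _] := leastP neG.
have [p pG rp] := coverG r rT.
(* The columns are pairwise different, so a path meeting all of them has length at least [W T]. *)
suff sub : {subset cols T <= unzip1 p.1}.
  apply: (leq_trans _ (leq_bigmax_seq p pG isT)).
  by rewrite -(size_map fst p.1) uniq_leq_size ?cols_uniq.
move=> f fT; apply: contraT => fp.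
have [r' [r'T neq eqr]] := crit f fT.
have r'p : r' \in domf (rows (restrict T p.1)).
  move: rp; rewrite !mem_restrict rT r'T /= => /allP rp.
  apply/allP => q qp; rewrite eqr ?rp//.
    by apply: contraNneq fp => <-; apply: map_f.
  (* An attribute on the path is a column because [r] has a value there. *)
  by apply: (@cell_cols T r) => //; rewrite (eqP (rp q qp)).
case: (pathG p pG) => [pL|same]; first by move: rp; rewrite pL inE.
case: neq; rewrite -(decision_restrict [` r'p]) -(decision_restrict [` rp]).
by rewrite !same.
Qed.

(** * Rows, columns and cells after deletion and relabeling *)

Lemma rows_mk_table (c : seq nat) (m : {fmap seq 'I_k -> 'I_2}) :
  uniq c -> (forall r, r \in domf m -> size r = size c) -> c != [::] ->
  rows (mk_table c m) = m.
Proof.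
by move=> Uc sz /negPf c0; rewrite /rows mk_tableE// c0 /=; case: eqP.
Qed.

Lemma cols_mk_table (c : seq nat) (m : {fmap seq 'I_k -> 'I_2}) :
  uniq c -> (forall r, r \in domf m -> size r = size c) ->
  (m = [fmap] -> c = [::]) -> cols (mk_table c m) = c.
Proof.
move=> Uc sz m0; rewrite /cols mk_tableE//.
by case: (c =P [::]) => [->|] //= c0; case: eqP => // /m0.
Qed.

Lemma size_project T D r : r \in domf (rows T) ->
  size (project D T r) = size [seq f <- cols T | f \notin D].
Proof.
move=> rT; rewrite size_mask ?size_map ?(size_row rT)//.
by rewrite size_filter count_map.
Qed.

Lemma cols_delete T D : cols (delete D T) = [seq f <- cols T | f \notin D].
Proof.
apply: cols_mk_table => [|s|/(congr1 (fun m => domf m)) /= m0].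
- by rewrite filter_uniq ?cols_uniq.
- by move=> /imfsetP[r /= rT ->]; rewrite size_project.
(* An empty map collapses the result to [Lambda], so no column may remain in that case: a row of [T]
   would leave its projection in the map, hence [T] has no rows and thus no columns. *)
have /eqP : rows T == [fmap].
  apply/eqP/fmap_nil/fsetP => r; rewrite inE; apply/negP => rT.
  suff : project D T r \in (fset0 : {fset seq 'I_k}) by rewrite inE.
  by rewrite -m0; apply: in_imfset.
by move/eqP; rewrite -table_emptyE => /eqP ->.
Qed.

Lemma mem_delete T D r : cols (delete D T) != [::] ->
  r \in domf (rows T) -> project D T r \in domf (rows (delete D T)).
Proof.
rewrite cols_delete => c0 rT; rewrite rows_mk_table ?filter_uniq ?cols_uniq//=.
  exact: in_imfset.
by move=> s /imfsetP[r' /= r'T ->]; rewrite size_project.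
Qed.

(** Columns and row lose the same positions, so a surviving column moves by the same amount in
    both. *)
Lemma onth_index_filter (X : Type) (P : pred nat) (c : seq nat) (r : seq X) f :
  P f -> size r = size c ->
  onth (mask [seq P g | g <- c] r) (index f [seq g <- c | P g]) =
  onth r (index f c).
Proof.
move=> Pf; elim: c r => [|g c IH] [|x r] //= [sr].
have [-> | neq] := eqVneq g f; first by rewrite Pf /= eqxx.
by case: (P g); rewrite /= ?(negPf neq) /= IH.
Qed.

Lemma cell_delete T D r f : r \in domf (rows T) -> f \notin D ->
  cell (delete D T) (project D T r) f = cell T r f.
Proof.
move=> rT fD; rewrite /cell cols_delete.
exact: (onth_index_filter fD (size_row rT)).
Qed.

Lemma rows_relabel T (nu : (W T).-tuple 'I_k -> 'I_2) :
  rows (relabel nu) = [fmap r : domf (rows T) => nu (row_tuple r)].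
Proof.
have [c0|c0] := eqVneq (cols T) [::]; last first.
  by apply: rows_mk_table => [||//]; [apply: cols_uniq | apply: size_row].
have /eqP r0 := c0; rewrite table_emptyE in r0.
rewrite /rows mk_tableE ?cols_uniq ?c0//=; last first.
  by move=> r /size_row; rewrite c0.
apply/esym/fmap_nil.
exact: (congr1 (fun m : {fmap _ -> _} => domf m) (eqP r0)).
Qed.

Lemma cols_relabel T (nu : (W T).-tuple 'I_k -> 'I_2) :
  cols (relabel nu) = cols T.
Proof.
apply: cols_mk_table => [|r|]; [exact: cols_uniq|exact: size_row|].
move=> /(congr1 (fun m => domf m)) /= /fmap_nil /eqP.
by rewrite -table_emptyE => /eqP.
Qed.

(** * Extraction of a hard table with a prescribed number of columns *)

Lemma critical_rows T n : n < S T ->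
  exists D (r : domf (rows T)), [/\ (D `<=` colset T)%fset, n < #|` D|
    & forall f, f \in D -> exists2 r' : domf (rows T),
        cell T (val r') f != cell T (val r) f
      & forall g, g \in D -> g != f -> cell T (val r') g = cell T (val r) g].
Proof.
move=> nS.
have [r nr] : exists r : domf (rows T), n < S_at r.
  apply/existsP; apply: contraLR nS; rewrite negb_exists -leqNgt => /forallP le.
  by apply/bigmax_leqP => r _; rewrite leqNgt le.
have ne : ([set #|` D| | D in [set D | separates r D]] !=set0)%classic.
  by have [D rD] := separators_neq0 r; exists #|` D|, D.
have [[D [DT sepD] Dr] minD] := leastP ne.
exists D, r; split=> // [|f fD]; first by rewrite Dr.
(* By minimality of [D], some row other than [r] agrees with [r] on [D] without [f]. *)
have : ~ separates r (D `\ f).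
  move=> sepf; have := minD _ (ex_intro2 _ _ _ sepf erefl).
  by rewrite -Dr [X in X <= _](cardfsD1 f) fD ltnn.
move=> nsep; apply: contrapT => nr'; apply: nsep; split.
  exact: fsubset_trans (fsubD1set _ _) DT.
move=> r' r'r; apply: contrapT => nf; apply: nr'.
have eqg g : g \in D -> g != f -> cell T (val r') g = cell T (val r) g.
  move=> gD gf; apply/eqP; apply: contraT => neq; case: nf; exists g.
    by rewrite !inE gf.
  by rewrite eq_sym.
exists r' => //; have [g gD neq] := sepD r' r'r.
(* [D] does separate [r'] from [r], and [f] is the only column left for that. *)
have [<-|gf] := eqVneq g f; first by rewrite eq_sym.
by rewrite eqg ?eqxx in neq.
Qed.

Lemma hard_subtable T n : n < S T ->
  exists T', [/\ span T T', W T' = n & n <= hd T'].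
Proof.
move=> /critical_rows[D [r [/fsubsetP DT nD crit]]].
have rT := fsvalP r.
(* Any [n] elements of [D] will do: the critical row of [f] agrees with [r] on the rest of [D],
   hence on the rest of [K]. *)
pose K := [fset f in take n (enum_fset D)].
have KD f : f \in K -> f \in D by rewrite inE => /mem_take.
have cK : #|` K| = n.
  by rewrite card_fseq undup_id ?take_uniq ?fset_uniq// size_takel// ltnW.
pose E := colset T `\` K.
have colsE : cols (delete E T) =i K.
  move=> f; rewrite cols_delete mem_filter !inE negb_and negbK.
  case: (boolP (f \in take _ _)) => [fK|_] /=; last by case: (f \in cols T).
  have /DT : f \in D by exact: mem_take fK.
  by rewrite inE.
have notE f : f \in K -> f \notin E by rewrite !inE => ->.
pose s := project E T (val r).
(* Rows may merge with [s] under the projection, which is harmless: the critical rows stay apart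
   from it. *)
pose nu (t : (W (delete E T)).-tuple 'I_k) : 'I_2 :=
  if tval t == s then ord0 else ord_max.
have colsT' : cols (relabel nu) =i K by move=> f; rewrite cols_relabel.
have WT' : W (relabel nu) = n.
  rewrite -card_colset -cK; congr #|` _|; apply/fsetP => f.
  by rewrite inE colsT'.
exists (relabel nu); split=> //; first by exists E, nu; rewrite fsubsetDl.
(* The case [n = 0] is trivial and must be set aside, since deleting all the columns also loses the
   rows. *)
case: n => [//|n] in nD K KD cK E colsE notE s nu colsT' WT' *.
have c0 : cols (delete E T) != [::].
  by rewrite -size_eq0 -(cols_relabel nu) -[size _]/(W (relabel nu)) WT'.
have mem_rows r' : r' \in domf (rows T) ->
    project E T r' \in domf (rows (relabel nu)).
  by move=> r'T; rewrite rows_relabel; apply: mem_delete.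
have rowsE r' : r' \in domf (rows T) ->
    (rows (relabel nu)).[? project E T r'] =
    Some (if project E T r' == s then ord0 else ord_max).
  move=> r'T; have := mem_rows r' r'T; rewrite rows_relabel => r'E.
  by rewrite (in_fnd r'E) ffunE.
have cellE r' f : r' \in domf (rows T) -> f \in K ->
    cell (relabel nu) (project E T r') f = cell T r' f.
  move=> r'T fK; rewrite -(cell_delete r'T (notE f fK)).
  by rewrite /cell cols_relabel.
rewrite -[X in X <= _]WT'; apply: (W_le_hd (mem_rows _ rT)) => f.
rewrite colsT' => fK; have [r' neq eqr'] := crit f (KD f fK).
have r'T := fsvalP r'; exists (project E T (val r')); split.
- exact: mem_rows.
(* A critical row projecting to [s] would agree with [r] in the retained column [f]. *)
- rewrite !rowsE// eqxx; case: eqP => // eqs.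
  by move: neq; rewrite -!(cellE _ f)// eqs eqxx.
- move=> g gf; rewrite colsT' => gK.
  by rewrite !cellE// eqr'// KD.
Qed.

End Bounds.

(** * Evaluation of both functions *)

Theorem theorem2 (k : nat) (hk : 2 <= k) (A : set (table k))
    (hA : closed_class A)
    (hS : forall m : nat, exists T : table k, A T /\ m < S T) :
  forall n : nat, F (@W k) A n = Some n /\ F (@Theta k) A n = Some n.
Proof.
move=> n; have k0 : 0 < k by apply: leq_trans hk.
have hd_Theta := fun T => hd_le_Theta T k0.
have [T [AT nT]] := hS n.
have [T' [TT' WT' hdT']] := hard_subtable nT.
have AT' : A T' by case: hA => _ <-; exists T.
have ThetaT' : Theta T' <= n by rewrite -WT' Theta_le_W.
(* In the chain from [n] through [hd T'] and [Theta T'] to [W T' = n] all terms coincide, so [T']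
   attains both maxima. *)
have hdT'E : hd T' = n.
  by apply/eqP; rewrite eqn_leq hdT' (leq_trans (hd_Theta _)).
split; apply/greatestP; split.
- by exists T' => //; split; rewrite ?WT'.
- move=> _ [T1 [_ WT1] <-].
  exact: leq_trans (hd_Theta _) (leq_trans (Theta_le_W _) WT1).
- by exists T'.
- by move=> _ [T1 [_ ThetaT1] <-]; apply: leq_trans (hd_Theta _) ThetaT1.
Qed.
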